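(* If $x$ and $y$ are numbers, then $x+y$ and $-x$ are numbers. Consequently, the equivalence classes (under $=$) of numbers form an abelian subGROUP (possibly on a proper class) of the abelian GROUP of equivalence classes of games under addition.
   Context: A game is an ordered pair $G=(L,R)$ of sets of games, where $L$ is the set of left options and $R$ the set of right options, subject to the Descending Game Condition: there is no infinite sequence of games $G^0,G^1,G^2,\dots$ in which every $G^{i+1}$ is a left or right option of $G^i$. The sets $L,R$ may be empty or infinite. $G^L$ and $G^R$ denote arbitrary left and right options of $G$. Order, defined recursively: $G\ge 0$ iff there is no right option $G^R$ with $G^R\le 0$; $G\le 0$ iff there is no left option $G^L$ with $G^L\ge 0$. $G=0$ means $G\ge 0$ and $G\le 0$; $G<0$ means $G\le 0$ and not $G\ge 0$. Arithmetic, defined recursively: $G+H$ has left options all $G^L+H$ and all $G+H^L$, and right options all $G^R+H$ and all $G+H^R$; $-G$ has left options all $-G^R$ and right options all $-G^L$; $G-H$ is $G+(-H)$. For two games, $G=H$ means $G-H=0$ and $G<H$ means $G-H<0$. The relation $=$ is a defined equivalence relation, and the equivalence classes of games form an abelian GROUP under the induced addition. Numbers (recursive definition): a game $x$ is a number if all left and right options of $x$ are numbers and $x^L<x^R$ for every left option $x^L$ and every right option $x^R$. *)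

(* Defs.v *)
From HB Require Import structures.
From mathcomp Require Import all_boot ssralg.
From mathcomp Require Import boolp.

Set Implicit Arguments.
Unset Strict Implicit.
Unset Printing Implicit Defensive.

Import GRing.Theory.
Local Open Scope quotient_scope.

(* A set of options is given as a family indexed by an arbitrary type, possibly
   empty or infinite. Since the options live in the type being defined, [game]
   sits one universe above its index types: it is a "proper class". *)
Inductive game : Type :=
  Game (L R : Type) (l : L -> game) (r : R -> game).

Definition left_option (g h : game) : Prop :=
  let: Game _ _ l _ := g in exists i, h = l i.

Definition right_option (g h : game) : Prop :=
  let: Game _ _ _ r := g in exists j, h = r j.

(* Well-foundedness is built into the inductive type. *)
Lemma descending_game_condition (G : nat -> game) :
  ~ (forall n, left_option (G n) (G n.+1) \/ right_option (G n) (G n.+1)).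
Proof.
move=> opt; suff H : forall g n, G n = g -> False by exact: (H (G 0) 0 erefl).
elim=> L R l IHl r IHr n Gn; have := opt n; rewrite Gn /=.
by case=> -[i Gi]; [exact: (IHl i n.+1)|exact: (IHr i n.+1)].
Qed.

Fixpoint ge0 (g : game) : Prop :=
  let: Game _ _ _ r := g in ~ exists j, le0 (r j)
with le0 (g : game) : Prop :=
  let: Game _ _ l _ := g in ~ exists i, ge0 (l i).

Definition eq0 (g : game) : Prop := ge0 g /\ le0 g.
Definition lt0 (g : game) : Prop := le0 g /\ ~ ge0 g.

Definition game0 : game :=
  Game (fun i : Empty_set => match i with end)
       (fun j : Empty_set => match j with end).

Fixpoint game_add (g : game) : game -> game :=
  match g with
  | Game Lg Rg lg rg =>
    fix add_g (h : game) : game :=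
      match h with
      | Game Lh Rh lh rh =>
        @Game (Lg + Lh) (Rg + Rh)
          (fun k => match k with
                    | inl i => game_add (lg i) h
                    | inr i => add_g (lh i)
                    end)
          (fun k => match k with
                    | inl j => game_add (rg j) h
                    | inr j => add_g (rh j)
                    end)
      end
  end.

Fixpoint game_opp (g : game) : game :=
  let: Game _ _ l r := g in
  Game (fun j => game_opp (r j)) (fun i => game_opp (l i)).

Definition game_sub (g h : game) : game := game_add g (game_opp h).

Definition game_eq (g h : game) : Prop := eq0 (game_sub g h).
Definition game_lt (g h : game) : Prop := lt0 (game_sub g h).

Fixpoint is_number (x : game) : Prop :=
  let: Game _ _ l r := x in
  [/\ forall i, is_number (l i),
      forall j, is_number (r j)
    & forall i j, game_lt (l i) (r j)].

(* Identity of games, i.e. having the same options up to identity; it is used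
   only to establish that [game_eq] is a congruence with the group laws. *)
Fixpoint iso (g h : game) : Prop :=
  match g, h with
  | Game Lg Rg lg rg, Game Lh Rh lh rh =>
    [/\ forall i, exists i', iso (lg i) (lh i'),
        forall i', exists i, iso (lg i) (lh i'),
        forall j, exists j', iso (rg j) (rh j')
      & forall j', exists j, iso (rg j) (rh j')]
  end.

Lemma iso_refl g : iso g g.
Proof. by elim: g => L R l IHl r IHr; split=> i; exists i. Qed.

Lemma iso_sym g h : iso g h -> iso h g.
Proof.
elim: g h => L R l IHl r IHr [L' R' l' r'] /= [H1 H2 H3 H4].
split=> i.
- by have [j /IHl] := H2 i; exists j.
- by have [j /IHl] := H1 i; exists j.
- by have [j /IHr] := H4 i; exists j.
- by have [j /IHr] := H3 i; exists j.
Qed.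

Lemma iso_trans h g k : iso g h -> iso h k -> iso g k.
Proof.
elim: g h k => L R l IHl r IHr [L' R' l' r'] [L'' R'' l'' r''] /=.
move=> [H1 H2 H3 H4] [K1 K2 K3 K4]; split=> i.
- by have [j /IHl p] := H1 i; have [j' /p] := K1 j; exists j'.
- by have [j p] := K2 i; have [j' /IHl q] := H2 j; exists j'; apply: q.
- by have [j /IHr p] := H3 i; have [j' /p] := K3 j; exists j'.
- by have [j p] := K4 i; have [j' /IHr q] := H4 j; exists j'; apply: q.
Qed.

Lemma iso_opp g h : iso g h -> iso (game_opp g) (game_opp h).
Proof.
elim: g h => L R l IHl r IHr [L' R' l' r'] /= [H1 H2 H3 H4].
split=> i.
- by have [j /IHr] := H3 i; exists j.
- by have [j /IHr] := H4 i; exists j.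
- by have [j /IHl] := H1 i; exists j.
- by have [j /IHl] := H2 i; exists j.
Qed.

Lemma iso_oppK g : iso (game_opp (game_opp g)) g.
Proof. by elim: g => L R l IHl r IHr; split=> i; exists i => /=. Qed.

Lemma iso_add g g' h h' :
  iso g g' -> iso h h' -> iso (game_add g h) (game_add g' h').
Proof.
elim: g g' h h' => L R l IHl r IHr [L' R' l' r'] h h' gg'.
elim: h h' => M S m IHm s IHs [M' S' m' s'] hh'.
have [H1 H2 H3 H4] := gg'; have [K1 K2 K3 K4] := hh'.
split=> -[i|i].
- by have [j p] := H1 i; exists (inl j); apply: IHl.
- by have [j p] := K1 i; exists (inr j); apply: IHm.
- by have [j p] := H2 i; exists (inl j); apply: IHl.
- by have [j p] := K2 i; exists (inr j); apply: IHm.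
- by have [j p] := H3 i; exists (inl j); apply: IHr.
- by have [j p] := K3 i; exists (inr j); apply: IHs.
- by have [j p] := H4 i; exists (inl j); apply: IHr.
- by have [j p] := K4 i; exists (inr j); apply: IHs.
Qed.

Lemma iso_addC g h : iso (game_add g h) (game_add h g).
Proof.
elim: g h => L R l IHl r IHr h; elim: h => M S m IHm s IHs.
split=> -[i|i].
- by exists (inr i); apply: IHl.
- by exists (inl i); apply: IHm.
- by exists (inr i); apply: IHm.
- by exists (inl i); apply: IHl.
- by exists (inr i); apply: IHr.
- by exists (inl i); apply: IHs.
- by exists (inr i); apply: IHs.
- by exists (inl i); apply: IHr.
Qed.

Lemma iso_addA g h k :
  iso (game_add g (game_add h k)) (game_add (game_add g h) k).
Proof.
elim: g h k => L R l IHl r IHr h k.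
elim: h k => M S m IHm s IHs k.
elim: k => N T n IHn t IHt.
split=> [[i|[i|i]]|[[i|i]|i]|[i|[i|i]]|[[i|i]|i]].
- by exists (inl (inl i)); apply: IHl.
- by exists (inl (inr i)); apply: IHm.
- by exists (inr i); apply: IHn.
- by exists (inl i); apply: IHl.
- by exists (inr (inl i)); apply: IHm.
- by exists (inr (inr i)); apply: IHn.
- by exists (inl (inl i)); apply: IHr.
- by exists (inl (inr i)); apply: IHs.
- by exists (inr i); apply: IHt.
- by exists (inl i); apply: IHr.
- by exists (inr (inl i)); apply: IHs.
- by exists (inr (inr i)); apply: IHt.
Qed.

Lemma iso_add0 g : iso (game_add game0 g) g.
Proof.
elim: g => L R l IHl r IHr.
split=> [[[]|i]|i|[[]|i]|i].
- by exists i; apply: IHl.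
- by exists (inr i); apply: IHl.
- by exists i; apply: IHr.
- by exists (inr i); apply: IHr.
Qed.

Lemma iso_oppD g h :
  iso (game_opp (game_add g h)) (game_add (game_opp g) (game_opp h)).
Proof.
elim: g h => L R l IHl r IHr h; elim: h => M S m IHm s IHs.
split=> -[i|i].
- by exists (inl i); apply: IHr.
- by exists (inr i); apply: IHs.
- by exists (inl i); apply: IHr.
- by exists (inr i); apply: IHs.
- by exists (inl i); apply: IHl.
- by exists (inr i); apply: IHm.
- by exists (inl i); apply: IHl.
- by exists (inr i); apply: IHm.
Qed.

Lemma iso_ge0_le0 g h : iso g h -> (ge0 g <-> ge0 h) /\ (le0 g <-> le0 h).
Proof.
elim: g h => L R l IHl r IHr [L' R' l' r'] /= [H1 H2 H3 H4].
split; split=> nx [i xi]; apply: nx.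
- by have [j /IHr[_ e]] := H4 i; exists j; apply/e.
- by have [j /IHr[_ e]] := H3 i; exists j; apply/e.
- by have [j /IHl[e _]] := H2 i; exists j; apply/e.
- by have [j /IHl[e _]] := H1 i; exists j; apply/e.
Qed.

Lemma iso_ge0 g h : iso g h -> ge0 g -> ge0 h.
Proof. by case/iso_ge0_le0=> -[]. Qed.

Lemma iso_le0 g h : iso g h -> le0 g -> le0 h.
Proof. by case/iso_ge0_le0=> _ []. Qed.

Lemma iso_eq0 g h : iso g h -> eq0 g -> eq0 h.
Proof. by move=> gh [/(iso_ge0 gh) ? /(iso_le0 gh) ?]. Qed.

Lemma opp_ge0_le0 g : (ge0 (game_opp g) <-> le0 g) /\ (le0 (game_opp g) <-> ge0 g).
Proof.
elim: g => L R l IHl r IHr /=.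
split; split=> nx [i xi]; apply: nx; exists i.
- by apply/(IHl i).2.
- by apply/(IHl i).2.
- by apply/(IHr i).1.
- by apply/(IHr i).1.
Qed.

Lemma opp_eq0 g : eq0 g -> eq0 (game_opp g).
Proof. by case=> ? ?; split; [apply/(opp_ge0_le0 g).1|apply/(opp_ge0_le0 g).2]. Qed.

Lemma ge0_add_aux g h :
  (ge0 g -> ge0 h -> ge0 (game_add g h)) /\
  (ge0 g -> le0 (game_add g h) -> le0 h) /\
  (ge0 h -> le0 (game_add g h) -> le0 g).
Proof.
elim: g h => L R l IHl r IHr h; elim: h => M S m IHm s IHs.
split; last split.
- move=> Hg Hh [[j|j] le].
  + by apply: Hg; exists j; apply: (IHr j _).2.2 le.
  + by apply: Hh; exists j; apply: (IHs j).2.1 le.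
- by move=> Hg le [i mi]; apply: le; exists (inr i); apply: (IHm i).1.
- by move=> Hh le [i li]; apply: le; exists (inl i); apply: (IHl i _).1.
Qed.

Lemma ge0_add g h : ge0 g -> ge0 h -> ge0 (game_add g h).
Proof. exact: (ge0_add_aux g h).1. Qed.

Lemma le0_addK g h : ge0 h -> le0 (game_add g h) -> le0 g.
Proof. exact: (ge0_add_aux g h).2.2. Qed.

Lemma eq0_add g h : eq0 g -> eq0 h -> eq0 (game_add g h).
Proof.
move=> [g1 g2] [h1 h2]; split; first exact: ge0_add.
apply/(opp_ge0_le0 _).1; apply: (iso_ge0 (iso_sym (iso_oppD g h))).
by apply: ge0_add; apply/(opp_ge0_le0 _).1.
Qed.

Lemma eq0_addK g h : eq0 h -> eq0 (game_add g h) -> eq0 g.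
Proof.
move=> h0 gh0; split; last exact: le0_addK h0.1 gh0.2.
apply/(opp_ge0_le0 _).2; apply: (@le0_addK _ (game_opp h)).
  exact: (opp_eq0 h0).1.
by apply: (iso_le0 (iso_oppD g h)); apply: (opp_eq0 gh0).2.
Qed.

Lemma le0_option g h : left_option g h -> ge0 h -> ~ le0 g.
Proof. by case: g => L R l r /= [i ->] li; apply; exists i. Qed.

Lemma option_addl g g' h :
  left_option g g' -> left_option (game_add g h) (game_add g' h).
Proof.
by case: g h => L R l r [M S m s] [i ->]; exists (inl i).
Qed.

Lemma option_addr g h h' :
  left_option h h' -> left_option (game_add g h) (game_add g h').
Proof.
by case: g h => L R l r [M S m s] [i ->]; exists (inr i).
Qed.

Lemma subgg g : eq0 (game_sub g g).
Proof.
suff H : ge0 (game_sub g g).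
  split=> //; apply/(opp_ge0_le0 _).1; apply: iso_ge0 H; apply: iso_sym.
  apply: (iso_trans (iso_oppD _ _)); apply: (iso_trans (iso_addC _ _)).
  exact: iso_add (iso_oppK _) (iso_refl _).
rewrite /game_sub; elim: g => L R l IHl r IHr [[j|j]].
  have opt := @option_addr (r j) (game_opp (Game l r)) (game_opp (r j)).
  by apply: le0_option (IHr j); apply: opt; exists j.
have opt := @option_addl (Game l r) (l j) (game_opp (l j)).
by apply: le0_option (IHl j); apply: opt; exists j.
Qed.

Lemma game_eq_refl g : game_eq g g.
Proof. exact: subgg. Qed.

Lemma iso_game_eq g h : iso g h -> game_eq g h.
Proof.
move=> gh; apply: iso_eq0 (subgg g).
exact: iso_add (iso_refl g) (iso_opp gh).
Qed.

Lemma game_eq_sym g h : game_eq g h -> game_eq h g.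
Proof.
move/opp_eq0; apply: iso_eq0; apply: (iso_trans (iso_oppD _ _)).
apply: (iso_trans (iso_addC _ _)).
exact: iso_add (iso_oppK _) (iso_refl _).
Qed.

Lemma iso_addACA a b c d :
  iso (game_add (game_add a b) (game_add c d))
      (game_add (game_add a c) (game_add b d)).
Proof.
apply: (iso_trans (iso_sym (iso_addA _ _ _))).
apply: iso_trans (iso_addA _ _ _); apply: iso_add (iso_refl _) _.
apply: (iso_trans (iso_addA _ _ _)); apply: iso_trans (iso_sym (iso_addA _ _ _)).
exact: iso_add (iso_addC _ _) (iso_refl _).
Qed.

Lemma game_eq_trans h g k : game_eq g h -> game_eq h k -> game_eq g k.
Proof.
move=> gh hk; apply: (eq0_addK (subgg h)).
apply: iso_eq0 (eq0_add gh hk).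
apply: (iso_trans (iso_add (iso_refl _) (iso_addC _ _))).
apply: (iso_trans (iso_addACA _ _ _ _)).
exact: iso_add (iso_refl _) (iso_addC _ _).
Qed.

Lemma game_eq_add g g' h h' :
  game_eq g g' -> game_eq h h' -> game_eq (game_add g h) (game_add g' h').
Proof.
move=> gg' hh'; apply: iso_eq0 (eq0_add gg' hh').
apply: (iso_trans (iso_addACA _ _ _ _)).
exact: iso_add (iso_refl _) (iso_sym (iso_oppD _ _)).
Qed.

Lemma game_eq_opp g h : game_eq g h -> game_eq (game_opp g) (game_opp h).
Proof. by move/opp_eq0; apply: iso_eq0; apply: iso_oppD. Qed.

Lemma game_addNg g : game_eq (game_add (game_opp g) g) game0.
Proof.
rewrite /game_eq; apply: (iso_eq0 _ (subgg g)).
apply: (iso_trans (iso_addC _ _)); apply: iso_sym.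
apply: (iso_trans (iso_addC _ _)).
by apply: iso_trans (iso_add0 _); apply: iso_add (iso_refl _); split=> -[].
Qed.

HB.instance Definition _ := gen_eqMixin game.
HB.instance Definition _ := gen_choiceMixin game.

Definition game_eqb : rel game := fun g h => `[< game_eq g h >].

Fact game_eqb_refl : reflexive game_eqb.
Proof. by move=> g; apply/asboolP; apply: game_eq_refl. Qed.

Fact game_eqb_sym : symmetric game_eqb.
Proof. by move=> g h; apply/asboolP/asboolP; apply: game_eq_sym. Qed.

Fact game_eqb_trans : transitive game_eqb.
Proof.
by move=> h g k /asboolP gh /asboolP hk; apply/asboolP; apply: game_eq_trans hk.
Qed.

Canonical game_equiv :=
  EquivRel game_eqb game_eqb_refl game_eqb_sym game_eqb_trans.

Definition game_class : Type := {eq_quot game_equiv}.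

HB.instance Definition _ := Choice.on game_class.
HB.instance Definition _ := EqQuotient.on game_class.

Lemma game_classP (g h : game) :
  (\pi_game_class g = \pi_game_class h) <-> game_eq g h.
Proof. by split=> [/eqmodP/asboolP|gh] //; apply/eqmodP/asboolP. Qed.

Definition class_add := lift_op2 game_class game_add.
Definition class_opp := lift_op1 game_class game_opp.

Lemma class_addE g h :
  class_add (\pi_game_class g) (\pi_game_class h) = \pi_game_class (game_add g h).
Proof.
rewrite /class_add -lock.
by apply/game_classP/game_eq_add; apply/game_classP; rewrite reprK.
Qed.

Lemma class_oppE g :
  class_opp (\pi_game_class g) = \pi_game_class (game_opp g).
Proof.
rewrite /class_opp -lock.
by apply/game_classP/game_eq_opp; apply/game_classP; rewrite reprK.
Qed.

Fact class_addA : associative class_add.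
Proof.
elim/quotW=> g; elim/quotW=> h; elim/quotW=> k; rewrite !class_addE.
by apply/game_classP/iso_game_eq; apply: iso_addA.
Qed.

Fact class_addC : commutative class_add.
Proof.
elim/quotW=> g; elim/quotW=> h; rewrite !class_addE.
by apply/game_classP/iso_game_eq; apply: iso_addC.
Qed.

Fact class_add0 : left_id (\pi_game_class game0) class_add.
Proof.
elim/quotW=> g; rewrite !class_addE.
by apply/game_classP/iso_game_eq; apply: iso_add0.
Qed.

Fact class_addN : left_inverse (\pi_game_class game0) class_opp class_add.
Proof.
elim/quotW=> g; rewrite class_oppE class_addE.
by apply/game_classP/game_addNg.
Qed.

HB.instance Definition _ :=
  GRing.isZmodule.Build game_class class_addA class_addC class_add0 class_addN.

Definition number_class : {pred game_class} :=
  fun c => `[< exists2 x, is_number x & c = \pi_game_class x >].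

(* Main.v *)
Require Import Defs.
From mathcomp Require Import all_boot ssralg.
From mathcomp Require Import boolp.

Set Implicit Arguments.
Unset Strict Implicit.
Unset Printing Implicit Defensive.

(** The options of [x + y] are of the form [x' + y] or [x + y'], so closure of
    the numbers under addition reduces to four inequalities. Two of them,
    [xL + y < xR + y] and [x + yL < x + yR], only use that addition preserves
    the order. The other two, [xL + y < x + yR] and [x + yL < xR + y], compare
    a number with its own options: they follow from [xL < x < xR]
    ([number_gt_left], [number_lt_right]) by adding two inequalities
    ([game_lt_add]).

    The inequality [xL < x] is where being a number matters: [x <= xL] fails
    for every game since [xL - xL = 0] is a right option of [xL - x], but
    [xL <= x] needs an induction on [x] together with the hypothesis
    [xL < xR]. Closure under negation reverses the inequalities between
    options ([game_lt_opp]), and also yields [x < xR] from its mirror image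
    [- xR < - x].

    The statement on classes is then immediate, because class addition and
    negation are computed on representatives. *)

Lemma iso_lt0 g h : iso g h -> lt0 g -> lt0 h.
Proof.
move=> gh [g_le g_nge]; split; first exact: iso_le0 gh g_le.
by move=> h_ge; apply/g_nge/(iso_ge0 (iso_sym gh)).
Qed.

Lemma le0_add g h : le0 g -> le0 h -> le0 (game_add g h).
Proof.
move=> g0 h0; apply/(opp_ge0_le0 _).1.
by apply: (iso_ge0 (iso_sym (iso_oppD g h))); apply: ge0_add;
  apply/(opp_ge0_le0 _).1.
Qed.

Lemma ge0_addK g h : le0 h -> ge0 (game_add g h) -> ge0 g.
Proof.
move=> h0 gh0; apply/(opp_ge0_le0 _).2; apply: (@le0_addK _ (game_opp h)).
  by apply/(opp_ge0_le0 _).1.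
by apply: (iso_le0 (iso_oppD g h)); apply/(opp_ge0_le0 _).2.
Qed.

Lemma lt0_add g h : lt0 g -> le0 h -> lt0 (game_add g h).
Proof.
move=> [g_le g_nge] h_le; split; first exact: le0_add.
by move/(ge0_addK h_le).
Qed.

Lemma game_lt_add a b c d :
  game_lt a b -> le0 (game_sub c d) -> game_lt (game_add a c) (game_add b d).
Proof.
move=> ab cd; apply: iso_lt0 (lt0_add ab cd).
apply: (iso_trans (iso_addACA _ _ _ _)).
exact: iso_add (iso_refl _) (iso_sym (iso_oppD _ _)).
Qed.

Lemma game_lt_add2r c a b :
  game_lt a b -> game_lt (game_add a c) (game_add b c).
Proof. by move=> ab; apply: game_lt_add (subgg c).2. Qed.

Lemma game_lt_add2l c a b :
  game_lt a b -> game_lt (game_add c a) (game_add c b).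
Proof.
move/(game_lt_add2r c); apply: iso_lt0.
by apply: iso_add (iso_addC _ _) (iso_opp (iso_addC _ _)).
Qed.

Lemma game_lt_opp a b : game_lt a b -> game_lt (game_opp b) (game_opp a).
Proof.
apply: iso_lt0; apply: (iso_trans (iso_addC _ _)).
exact: iso_add (iso_refl _) (iso_sym (iso_oppK a)).
Qed.

Lemma game_lt_oppK a b : game_lt (game_opp b) (game_opp a) -> game_lt a b.
Proof.
apply: iso_lt0; apply: (iso_trans (iso_addC _ _)).
exact: iso_add (iso_oppK a) (iso_refl _).
Qed.

Lemma le0_add_option g h :
  (forall g', left_option g g' -> ~ ge0 (game_add g' h)) ->
  (forall h', left_option h h' -> ~ ge0 (game_add g h')) ->
  le0 (game_add g h).
Proof.
case: g h => L R l r [M S m s] Hg Hh [[i|i] ge].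
- by apply: Hg ge; exists i.
- by apply: Hh ge; exists i.
Qed.

Lemma ge0_option g h : right_option g h -> le0 h -> ~ ge0 g.
Proof. by case: g => L R l r /= [j ->] rj; apply; exists j. Qed.

Lemma right_option_addr g h h' :
  right_option h h' -> right_option (game_add g h) (game_add g h').
Proof. by case: g h => L R l r [M S m s] [j ->]; exists (inr j). Qed.

Lemma right_option_opp g h :
  left_option g h -> right_option (game_opp g) (game_opp h).
Proof. by case: g => L R l r [i ->]; exists i. Qed.

Lemma left_option_opp g h :
  right_option g h -> left_option (game_opp g) (game_opp h).
Proof. by case: g => L R l r [j ->]; exists j. Qed.

(** [(a - g) + (b - b)] rearranges to [(b - g) + (a - b)], so adding the zero
    game [b - b] reduces transitivity to the cancellation [ge0_addK]. *)
Lemma ge0_sub_trans a b g :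
  le0 (game_sub a b) -> ge0 (game_sub a g) -> ge0 (game_sub b g).
Proof.
move=> ab ag; apply: (ge0_addK ab).
apply: (iso_ge0 _ (ge0_add ag (subgg b).1)).
apply: (iso_trans (iso_addACA _ _ _ _)).
apply: (iso_trans (iso_add (iso_addC _ _) (iso_refl _))).
exact: iso_addACA.
Qed.

(** Holds for every game: Right can move from [y - x] to [y - y]. *)
Lemma left_option_nge x y : left_option x y -> ~ ge0 (game_sub y x).
Proof.
move=> xy; apply: ge0_option (subgg y).2.
by apply: right_option_addr; apply: right_option_opp.
Qed.

(** A left option of [xL - x] is either [xL - xR], which is negative because
    [x] is a number, or [xLL - x]. If the latter were nonnegative then, as
    [xLL < xL] by induction, so would be [xL - x]. *)
Lemma number_gt_left x y : is_number x -> left_option x y -> game_lt y x.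
Proof.
elim: x y => L R l IHl r _ y /= [nl nr lr] [i ->].
have li_nge : ~ ge0 (game_sub (l i) (Game l r)).
  by apply: left_option_nge; exists i.
split=> //; apply: le0_add_option => [g' /(IHl i _ (nl i))[g'_le _] ge|h' [j ->]].
  exact/li_nge/(ge0_sub_trans g'_le).
exact: (lr i j).2.
Qed.

Lemma number_opp x : is_number x -> is_number (game_opp x).
Proof.
elim: x => L R l IHl r IHr /= [nl nr lr]; split=> [j|i|j i].
- exact: IHr.
- exact: IHl.
- exact: game_lt_opp.
Qed.

Lemma number_lt_right x y : is_number x -> right_option x y -> game_lt x y.
Proof.
move=> /number_opp nx /left_option_opp opt.
exact/game_lt_oppK/number_gt_left.
Qed.

Lemma number_add x y : is_number x -> is_number y -> is_number (game_add x y).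
Proof.
elim: x y => L R l IHl r IHr y nx; elim: y => M S m IHm s IHs ny.
have [nl nr lr] := nx; have [nm ns ms] := ny.
have lx i : game_lt (l i) (Game l r) by apply: number_gt_left => //; exists i.
have xr j : game_lt (Game l r) (r j) by apply: number_lt_right => //; exists j.
have my i : game_lt (m i) (Game m s) by apply: number_gt_left => //; exists i.
have ys j : game_lt (Game m s) (s j) by apply: number_lt_right => //; exists j.
split=> [[i|i]|[j|j]|[i|i] [j|j]].
- exact: IHl (nl i) ny.
- exact: IHm (nm i).
- exact: IHr (nr j) ny.
- exact: IHs (ns j).
- exact: game_lt_add2r.
- exact: game_lt_add (lx i) (ys j).1.
- exact: game_lt_add (xr j) (my i).1.
- exact: (game_lt_add2l (Game l r) (ms i j)).
Qed.

Theorem theorem3p3 :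
  (forall x y : game, is_number x -> is_number y ->
     is_number (game_add x y) /\ is_number (game_opp x))
  /\ GRing.zmod_closed number_class.
Proof.
split=> [x y nx ny|]; first by split; [exact: number_add|exact: number_opp].
split=> [|_ _ /asboolP[x nx ->] /asboolP[y ny ->]]; apply/asboolP.
  by exists game0; [split=> -[]|].
exists (game_sub x y); first exact: number_add nx (number_opp ny).
by rewrite -class_addE -class_oppE.
Qed.
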